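(* Let $s \in \mathbb{N}=\{1,2,3,\dots\}$. For all $n_1, n_2, \ldots, n_s, k \in \mathbb{Z}_+=\{0,1,2,\dots\}$ with $n_1+n_2+\cdots+n_s > sk$, $$\sum_{j=0}^{n_1+\cdots+n_s-sk}\binom{n_1+\cdots+n_s-sk}{j}(-1)^{j}E_{j+sk} = \begin{cases} 2+E_{n_1+n_2+\cdots+n_s} & \text{if } k=0,\\[2mm] \displaystyle\sum_{j=0}^{sk}\binom{sk}{j}(-1)^{sk-j}E_{n_1+n_2+\cdots+n_s-j} & \text{if } k>0.\end{cases}$$
   Context: The Euler numbers $E_n\in\mathbb{Q}$ ($n\ge 0$) are defined by $\frac{2}{e^t+1} = \sum_{n=0}^{\infty} E_n \frac{t^n}{n!}$. *)

(* Defs.v *)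
From mathcomp Require Import all_boot all_order all_algebra.

Set Implicit Arguments.
Unset Strict Implicit.
Unset Printing Implicit Defensive.

Import Order.TTheory GRing.Theory Num.Theory.
Local Open Scope ring_scope.

(* MathComp has no formal power series: a series over F is represented by its
   sequence of coefficients, [f n] being the coefficient of t^n. *)
Definition fps (F : Type) := nat -> F.

Definition fps_const (F : fieldType) (c : F) : fps F :=
  fun n => if n == 0%N then c else 0.

Definition fps_add (F : fieldType) (f g : fps F) : fps F :=
  fun n => f n + g n.

Definition fps_mul (F : fieldType) (f g : fps F) : fps F :=
  fun n => \sum_(i < n.+1) f i * g (n - i)%N.

(* First n coefficients of 1/f, by solving f * g = 1 degree by degree;
   meaningful only when f 0 != 0. *)
Fixpoint fps_inv_prefix (F : fieldType) (f : fps F) (n : nat) : seq F :=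
  if n is m.+1 then
    let s := fps_inv_prefix f m in
    rcons s ((f 0%N)^-1 * ((m == 0%N)%:R - \sum_(i < m) f (m - i)%N * s`_i))
  else [::].

Definition fps_inv (F : fieldType) (f : fps F) : fps F :=
  fun n => (fps_inv_prefix f n.+1)`_n.

Definition fps_div (F : fieldType) (f g : fps F) : fps F :=
  fps_mul f (fps_inv g).

Definition fps_exp : fps rat := fun n => (n`!%:R)^-1.

(* E_n / n! is the coefficient of t^n in 2 / (e^t + 1). *)
Definition euler_number (n : nat) : rat :=
  n`!%:R * fps_div (fps_const 2) (fps_add fps_exp (fps_const 1)) n.

Lemma size_fps_inv_prefix (F : fieldType) (f : fps F) n :
  size (fps_inv_prefix f n) = n.
Proof. by elim: n => //= n IHn; rewrite size_rcons IHn. Qed.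

Lemma nth_fps_inv_prefix (F : fieldType) (f : fps F) n i :
  (i < n)%N -> (fps_inv_prefix f n)`_i = fps_inv f i.
Proof.
elim: n => // n IHn; rewrite ltnS leq_eqVlt => /orP[/eqP-> //|lt_in].
by rewrite /= nth_rcons size_fps_inv_prefix lt_in IHn.
Qed.

Lemma fps_invE (F : fieldType) (f : fps F) n :
  fps_inv f n =
    (f 0%N)^-1 * ((n == 0%N)%:R - \sum_(i < n) f (n - i)%N * fps_inv f i).
Proof.
rewrite {1}/fps_inv /= nth_rcons size_fps_inv_prefix ltnn eqxx.
by congr (_ * (_ - _)); apply: eq_bigr => i _; rewrite nth_fps_inv_prefix.
Qed.

Lemma fps_mulfV (F : fieldType) (f : fps F) :
  f 0%N != 0 -> fps_mul f (fps_inv f) =1 fps_const 1.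
Proof.
move=> f0 n; rewrite /fps_mul (reindex_inj rev_ord_inj) big_ord_recr /=.
rewrite subnn subn0 fps_invE mulVKf // addrC -addrA.
rewrite [X in _ + (- _ + X)](eq_bigr (fun i : 'I_n =>
  f (n - i)%N * fps_inv f i)) => [|i _].
  by rewrite addNr addr0 /fps_const; case: eqP.
by rewrite subSS subKn // ltnW.
Qed.

Lemma fps_mul_cancel (F : fieldType) (f g h : fps F) :
  f 0%N != 0 -> fps_mul f g =1 fps_mul f h -> g =1 h.
Proof.
move=> f0 eq_fgh n; elim/ltn_ind: n => n IHn.
have := eq_fgh n; rewrite /fps_mul !big_ord_recl subn0.
rewrite [X in _ + X = _](eq_bigr (fun i : 'I_n =>
  f (lift ord0 i) * h (n - lift ord0 i)%N)) => [|i _].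
  by move/addIr/(mulfI f0).
have lt_in := ltn_ord i.
by rewrite IHn // lift0 ltn_subrL (leq_ltn_trans _ lt_in).
Qed.

Lemma euler_numberP :
  fps_mul (fps_add fps_exp (fps_const 1)) (fun n => euler_number n / n`!%:R)
    =1 fps_const 2.
Proof.
set D := fps_add _ _.
have D0 : D 0%N != 0 by [].
move=> n; rewrite /fps_mul.
have cE i : euler_number i / i`!%:R = 2 * fps_inv D i.
  rewrite /euler_number mulrC mulKf ?pnatr_eq0 -?lt0n ?fact_gt0 //.
  rewrite /fps_div /fps_mul big_ord_recl subn0 big1 ?addr0 // => j _.
  by rewrite /fps_const lift0 mul0r.
under eq_bigr do rewrite cE mulrCA.
rewrite -mulr_sumr -/(fps_mul D (fps_inv D) n) fps_mulfV // /fps_const.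
by case: eqP; rewrite ?mulr1 ?mulr0.
Qed.

(* Main.v *)
Require Import Defs.
From HB Require Import structures.
From mathcomp Require Import all_boot all_order all_algebra.
From mathcomp Require Import ring.

(** Let [L] be the linear functional on polynomials with [L(x^n) = E_n].  The
    defining identity of the Euler numbers says
    [L(r(x+1)) + L(r) = 2 r(0)].  Every polynomial [p] has the form
    [r(x) + r(x+1)], and then [p(1-x) = u(x) + u(x+1)] with [u(x) = r(2-x)];
    hence [L(p(1-x)) - L(p) = 2 (r(2) - r(0)) = 2 (p(1) - p(0))].  The theorem
    is the case [p = x^M (1-x)^m], with [m = sk] and [M = n_1+...+n_s - sk]. *)

Import GRing.Theory Num.Theory.
Local Open Scope ring_scope.

Lemma poly_linear_ind (R : nzRingType) (P : {poly R} -> Prop) :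
    (forall a p q, P p -> P q -> P (a *: p + q)) ->
  (forall n, P 'X^n) -> forall p, P p.
Proof.
move=> Plin PX p.
have P0 : P 0.
  by rewrite -(addNr 'X^0) -scaleN1r; apply: Plin; apply: PX.
rewrite -[p]coefK poly_def; elim/big_ind: _ => // [q r Pq Pr|i _].
  by rewrite -[q]scale1r; apply: Plin.
by rewrite -[_ *: _]addr0; apply: Plin.
Qed.

(** Compare coefficients of $t^n$ in $(e^t+1)\sum_i E_i t^i/i! = 2$ and multiply by $n!$. The factor
    $e^t$ gives the binomial sum, the constant $1$ the lone $E_n$. *)
Lemma euler_number_rec n :
  \sum_(i < n.+1) 'C(n, i)%:R * euler_number i + euler_number n
    = if n == 0%N then 2 else 0.
Proof.
have fact_neq0 m : m`!%:R != 0 :> rat by rewrite pnatr_eq0 -lt0n fact_gt0.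
transitivity (n`!%:R * fps_const 2 n : rat); last first.
  by rewrite /fps_const; case: eqP => [->|_]; rewrite ?mul1r ?mulr0.
rewrite -euler_numberP /fps_mul mulr_sumr.
under [RHS]eq_bigr do rewrite mulrDl mulrDr.
rewrite big_split /=; congr (_ + _); last first.
  rewrite big_ord_recl big1 => [|i _]; last first.
    by rewrite /fps_const lift0 mul0r mulr0.
  by rewrite addr0 subn0 /fps_const mul1r mulrCA divff ?mulr1.
rewrite (reindex_inj rev_ord_inj) /=; apply: eq_bigr => i _.
have le_in : (i <= n)%N by rewrite -ltnS.
rewrite subSS /fps_exp (bin_sub le_in) -(bin_fact le_in) !natrM.
by field; rewrite !fact_neq0.
Qed.

Definition euler_functional (p : {poly rat}) : rat :=
  \sum_(i < size p) p`_i * euler_number i.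

(** Padding with zero coefficients gives polynomials of different sizes a common summation range, as
    the proof of linearity requires. *)
Lemma euler_functionalE n (p : {poly rat}) : (size p <= n)%N ->
  euler_functional p = \sum_(i < n) p`_i * euler_number i.
Proof.
move=> le_pn; rewrite /euler_functional.
rewrite (big_ord_widen _ (fun i => p`_i * euler_number i) le_pn).
rewrite big_mkcond /=; apply: eq_bigr => i _.
by case: ltnP => // le_pi; rewrite nth_default ?mul0r.
Qed.

Lemma euler_functional_is_scalar : scalar euler_functional.
Proof.
move=> a p q; set n := maxn (size p) (size q).
have le_n : (size (a *: p + q)%R <= n)%N.
  by rewrite (leq_trans (size_polyD _ _)) // geq_max !leq_max leqnn orbT
    size_scale_leq.
rewrite (euler_functionalE _ _ le_n).
rewrite !(@euler_functionalE n) ?leq_maxl ?leq_maxr //.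
rewrite mulr_sumr -big_split; apply: eq_bigr => i _ /=.
by rewrite coefD coefZ mulrDl mulrA.
Qed.

HB.instance Definition _ := GRing.isLinear.Build rat {poly rat} rat *%R
  euler_functional euler_functional_is_scalar.

Lemma euler_functionalXn n : euler_functional 'X^n = euler_number n.
Proof.
rewrite /euler_functional size_polyXn big_ord_recr /= coefXn eqxx mul1r.
by rewrite big1 ?add0r // => i _; rewrite coefXn ltn_eqF ?mul0r.
Qed.

(** By linearity it suffices to take $p = x^n$; expanding $(x+1)^n$ then gives the recurrence
    [euler_number_rec]. *)
Lemma euler_functional_shift p :
  euler_functional (p \Po ('X + 1)) + euler_functional p = 2 * p.[0].
Proof.
elim/poly_linear_ind: p => [a p q IHp IHq|n].
  rewrite comp_polyD comp_polyZ !linearP hornerD hornerZ /=.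
  by rewrite mulrDr mulrCA -IHp -IHq; ring.
rewrite comp_Xn_poly addrC exprD1n raddf_sum /= hornerXn.
rewrite (_ : 2 * 0 ^+ n = if n == 0%N then 2 else 0); last first.
  by rewrite expr0n; case: eqP; rewrite ?mulr1 ?mulr0.
rewrite -euler_number_rec euler_functionalXn addrC; congr (_ + _).
apply: eq_bigr => i _ /=.
by rewrite raddfMn /= euler_functionalXn mulr_natl.
Qed.

(** The map $r \mapsto r(x) + r(x+1)$ sends $x^n$ to $2x^n$ plus terms of lower degree, so strong
    induction on $n$ reaches every monomial. *)
Lemma poly_add_shift_surj (F : numFieldType) (p : {poly F}) :
  exists r, p = r + (r \Po ('X + 1)).
Proof.
elim/poly_linear_ind: p => [a p q [r ->] [u ->]|n].
  exists (a *: r + u); rewrite comp_polyD comp_polyZ scalerDr.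
  by rewrite addrACA.
elim/ltn_ind: n => n IHn.
(* This sum is $(x+1)^n - x^n$, the lower-degree part to be cancelled. *)
have [r Dr] : exists r, \sum_(i < n) 'X^i *+ 'C(n, i) = r + (r \Po ('X + 1))
      :> {poly F}.
  elim/big_ind: _ => [|p q [r ->] [u ->]|i _].
  - by exists 0; rewrite comp_poly0 addr0.
  - by exists (r + u); rewrite comp_polyD addrACA.
  - have [r ->] := IHn i (ltn_ord i).
    by exists (r *+ 'C(n, i)); rewrite mulrnDl raddfMn.
exists (2^-1 *: ('X^n - r)).
rewrite comp_polyZ -scalerDr comp_polyB comp_Xn_poly addrACA -opprD -Dr.
rewrite exprD1n big_ord_recr /= binn mulr1n [_ + 'X^n]addrC addrA addrK.
by rewrite -mulr2n -scaler_nat scalerA mulVf ?scale1r ?pnatr_eq0.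
Qed.

Lemma euler_functional_reflect p :
  euler_functional (p \Po (1 - 'X)) = euler_functional p + 2 * (p.[1] - p.[0]).
Proof.
have [r ->] := poly_add_shift_surj _ p.
have -> : (r + (r \Po ('X + 1))) \Po (1 - 'X)
    = (r \Po (2 - 'X)) \Po ('X + 1) + (r \Po (2 - 'X)).
  rewrite comp_polyD -!comp_polyA; congr ((_ \Po _) + (_ \Po _));
    rewrite !(comp_polyB, comp_polyD, comp_polyX, rmorph1, rmorph_nat) /=; ring.
rewrite linearD /= euler_functional_shift.
rewrite linearD /= (addrC (euler_functional r)) euler_functional_shift.
(* What remains is $2r(2) = 2r(0) + 2(p(1) - p(0))$ with $p(1) - p(0) = (r(1) + r(2)) - (r(0) +
   r(1))$. *)
rewrite !(hornerD, horner_comp, hornerN, hornerX, hornerE) /=.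
by ring.
Qed.

Lemma euler_functional_mul_subX a b :
  euler_functional ('X^a * (1 - 'X) ^+ b)
    = \sum_(0 <= i < b.+1) 'C(b, i)%:R * (-1) ^+ i * euler_number (i + a).
Proof.
rewrite big_mkord exprBn mulr_sumr raddf_sum; apply: eq_bigr => i _ /=.
rewrite expr1n mulr1 mulrnAr mulrCA -exprD raddfMn /= -signr_odd.
rewrite -(rmorph_sign (@polyC rat)) mul_polyC linearZ /= euler_functionalXn.
by rewrite signr_odd addnC -mulrA mulr_natl.
Qed.

(** Reflection exchanges the two polynomials. For $p = x^a(1-x)^b$, $p(0) = 0$ since $a > 0$, while
    $p(1) = 0^b$ is $1$ exactly when $b = 0$. *)
Lemma euler_functional_swap a b : (0 < a)%N ->
  euler_functional ('X^b * (1 - 'X) ^+ a)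
    = euler_functional ('X^a * (1 - 'X) ^+ b) + 2 * (b == 0%N)%:R.
Proof.
move=> a_gt0.
have -> : 'X^b * (1 - 'X) ^+ a = ('X^a * (1 - 'X) ^+ b) \Po (1 - 'X)
    :> {poly rat}.
  rewrite !(rmorphM, rmorphXn) /= comp_polyB comp_polyX rmorph1 mulrC.
  by rewrite subKr.
rewrite euler_functional_reflect.
rewrite !(hornerM, horner_exp, hornerD, hornerN, hornerX, hornerC) /=.
by rewrite subrr oppr0 addr0 !expr1n !expr0n (gtn_eqF a_gt0) mul1r mul0r subr0.
Qed.

Theorem corollary11 (s : nat) (hs : (0 < s)%N) (n : 'I_s -> nat) (k : nat)
    (hk : (s * k < \sum_(i < s) n i)%N) :
  \sum_(0 <= j < (\sum_(i < s) n i - s * k).+1)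
     'C(\sum_(i < s) n i - s * k, j)%:R * (-1) ^+ j * euler_number (j + s * k)
  = if k == 0%N then 2 + euler_number (\sum_(i < s) n i)
    else \sum_(0 <= j < (s * k).+1)
           'C(s * k, j)%:R * (-1) ^+ (s * k - j)
             * euler_number (\sum_(i < s) n i - j).
Proof.
have M_gt0 : (0 < \sum_(i < s) n i - s * k)%N by rewrite subn_gt0.
rewrite -euler_functional_mul_subX euler_functional_swap //.
(* As $s > 0$, the correction term is present exactly when $k = 0$. *)
rewrite muln_eq0 (gtn_eqF hs) /=.
case: eqP => [-> | _].
  by rewrite muln0 subn0 mulr1 euler_functionalXn addrC.
(* The reversal $j \mapsto sk - j$ produces the sign $(-1)^{sk-j}$ and the index $(sk - j) + M = n_1
   + \cdots + n_s - j$. *)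
rewrite mulr0 addr0 euler_functional_mul_subX big_nat_rev.
apply: eq_big_nat => j; rewrite add0n subSS ltnS => /andP[_ le_j].
rewrite bin_sub //; congr (_ * euler_number _).
by rewrite addnC addnBA // subnK // ltnW.
Qed.
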